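(* Let $H_S\in\mathbb C^{2\times 2}$ be Hermitian and non-degenerate, $H_S=E_1|g_1\rangle\langle g_1|+E_2|g_2\rangle\langle g_2|$ with $E_1<E_2$ and $\{g_1,g_2\}$ an orthonormal basis of $\mathbb C^2$, let $\Delta E:=E_2-E_1$, and let $T\in(0,\infty]$ (with $e^{-\Delta E/T}:=1$ if $T=\infty$). (a) A linear map $S:\mathbb C^{2\times 2}\to\mathbb C^{2\times 2}$ belongs to $\mathsf{EnTO}(H_S,T)$ if and only if there exist $\lambda\in[0,1]$, $r\in\big[0,\sqrt{(1-\lambda)(1-\lambda e^{-\Delta E/T})}\big]$ and $\phi\in[-\pi,\pi)$ such that the Choi matrix of $S$ with respect to $\{g_1,g_2\}$ is $$\begin{pmatrix} 1-\lambda e^{-\Delta E/T} & 0 & 0 & r e^{i\phi} \\ 0 & \lambda e^{-\Delta E/T} & 0 & 0 \\ 0 & 0 & \lambda & 0 \\ {r} e^{-i\phi} & 0 & 0 & 1-\lambda \end{pmatrix}.\qquad(\ast)$$ (b) Let $D(\Psi_T)$ be the set of all linear maps on $\mathbb C^{2\times 2}$ whose Choi matrix with respect to $\{g_1,g_2\}$ has the form $(\ast)$ for some $\lambda\in\mathbb R$, $r\ge0$, $\phi\in[-\pi,\pi)$. Then $$\Psi_T:D(\Psi_T)\to\mathbb R\times\mathbb C,\qquad S\mapsto\big(\langle g_1,S(|g_2\rangle\langle g_2|)g_1\rangle,\ \langle g_1,S(|g_1\rangle\langle g_2|)g_2\rangle\big)$$ is a faithful semigroup representation, i.e. an injective map with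 $\Psi_T(S_1\circ S_2)=\Psi_T(S_1)\circ_T\Psi_T(S_2)$ for all $S_1,S_2\in D(\Psi_T)$, where $\circ_T$ is the associative operation on $\mathbb R\times\mathbb C$ given by $$(\lambda_1,c_1)\circ_T(\lambda_2,c_2)=\big(\lambda_1+\lambda_2-\lambda_1\lambda_2(1+e^{-\Delta E/T}),\ c_1c_2\big),$$ which has neutral element $(0,1)$.
   Context: The enhanced thermal operations $\mathsf{EnTO}(H_S,T)$ are all completely positive trace-preserving linear maps $S$ on $\mathbb C^{2\times 2}$ with $S(e^{-H_S/T})=e^{-H_S/T}$ (resp. $S(\mathbb 1)=\mathbb 1$ if $T=\infty$) and $[S,\operatorname{ad}_{H_S}]=0$, where $\operatorname{ad}_{H_S}=[H_S,\cdot\,]$. The Choi matrix of $S$ with respect to $\{g_1,g_2\}$ is the matrix of $\sum_{i,j=1}^2|g_i\rangle\langle g_j|\otimes S(|g_i\rangle\langle g_j|)$ in the ordered basis $g_1\otimes g_1,\,g_1\otimes g_2,\,g_2\otimes g_1,\,g_2\otimes g_2$. *)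

(* Defs.v *)
From HB Require Import structures.
From mathcomp Require Import all_boot all_order all_algebra.
From mathcomp Require Import sesquilinear spectral complex mxtens.
From mathcomp Require Import all_classical all_reals all_analysis.
Set Implicit Arguments.
Unset Strict Implicit.
Unset Printing Implicit Defensive.
Import Order.TTheory GRing.Theory Num.Theory numFieldNormedType.Exports.
Local Open Scope ring_scope.
Local Open Scope complex_scope.
Local Open Scope sesquilinear_scope.
Local Open Scope classical_set_scope.

(* e^{i phi} *)
Definition expi (R : realType) (phi : R) : R[i] := cos phi +i* sin phi.

(* <u, v>, antilinear in the first argument *)
Definition inner (R : realType) (m : nat) (u v : 'cV[R[i]]_m) : R[i] :=
  (u^t* *m v) 0 0.

(* |u><v| *)
Definition ketbra (R : realType) (m : nat) (u v : 'cV[R[i]]_m) : 'M[R[i]]_m :=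
  u *m v^t*.

(* In C^d, a family of d orthonormal vectors is automatically a basis. *)
Definition orthonormal_basis (R : realType) (d : nat)
    (g : 'I_d -> 'cV[R[i]]_d) : Prop :=
  forall i j : 'I_d, inner (g i) (g j) = (i == j)%:R.

(* The limit is taken in the finite-dimensional space of matrices; R[i]^o is
   R[i] with the topology given by the modulus. *)
Definition mxexp (R : realType) (d : nat) (A : 'M[R[i]]_d) : 'M[R[i]]_d :=
  lim ((series (fun k => (k`!%:R)^-1 *: A ^+ k) : nat -> 'M[R[i]^o]_d) @ \oo).

(* On R[i], 0 <= z says that z is real and nonnegative. *)
Definition psdmx (R : realType) (m : nat) (A : 'M[R[i]]_m) : Prop :=
  A \is hermsymmx /\ forall v : 'cV[R[i]]_m, 0 <= inner v (A *m v).

Definition mxtens_block (R : realType) (n d : nat) (X : 'M[R[i]]_(n * d))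
    (i j : 'I_n) : 'M[R[i]]_d :=
  \matrix_(k < d, l < d) X (mxtens_index (i, k)) (mxtens_index (j, l)).

(* id_n (x) S on M_n (x) M_d = M_(n * d), i.e. S applied to each block *)
Definition ampliation (R : realType) (n d : nat) (S : 'End('M[R[i]]_d))
    (X : 'M[R[i]]_(n * d)) : 'M[R[i]]_(n * d) :=
  \sum_(i < n) \sum_(j < n) delta_mx i j *t S (mxtens_block X i j).

Definition completely_positive (R : realType) (d : nat)
    (S : 'End('M[R[i]]_d)) : Prop :=
  forall (n : nat) (X : 'M[R[i]]_(n * d)), psdmx X -> psdmx (ampliation S X).

Definition trace_preserving (R : realType) (d : nat)
    (S : 'End('M[R[i]]_d)) : Prop :=
  forall X : 'M[R[i]]_d, \tr (S X) = \tr X.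

Definition ad (R : realType) (d : nat) (H X : 'M[R[i]]_d) : 'M[R[i]]_d :=
  H *m X - X *m H.

(* T ranges over (0, +oo]; the value at T = -oo is irrelevant. *)
Definition gibbs_preserving (R : realType) (d : nat) (H : 'M[R[i]]_d)
    (T : \bar R) (S : 'End('M[R[i]]_d)) : Prop :=
  match T with
  | EFin t => S (mxexp (- (t^-1)%:C *: H)) = mxexp (- (t^-1)%:C *: H)
  | _ => S 1%:M = 1%:M
  end.

Definition EnTO (R : realType) (d : nat) (H : 'M[R[i]]_d) (T : \bar R)
    (S : 'End('M[R[i]]_d)) : Prop :=
  [/\ completely_positive S,
      trace_preserving S,
      gibbs_preserving H T S
    & forall X : 'M[R[i]]_d, S (ad H X) = ad H (S X)].

(* e^{-x/T}, equal to 1 at T = +oo; the value at T = -oo is irrelevant. *)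
Definition boltzmann (R : realType) (x : R) (T : \bar R) : R :=
  match T with
  | EFin t => expR (- x / t)
  | _ => 1
  end.

Definition choi_op (R : realType) (d : nat) (g : 'I_d -> 'cV[R[i]]_d)
    (S : 'End('M[R[i]]_d)) : 'M[R[i]]_(d * d) :=
  \sum_(i < d) \sum_(j < d) ketbra (g i) (g j) *t S (ketbra (g i) (g j)).

(* mxtens_unindex enumerates the pairs (i, j) lexicographically, so the product
   basis is ordered g_1 (x) g_1, g_1 (x) g_2, ..., g_d (x) g_d. *)
Definition tens_basis (R : realType) (d : nat) (g : 'I_d -> 'cV[R[i]]_d)
    (k : 'I_(d * d)) : 'cV[R[i]]_(d * d) :=
  g (mxtens_unindex k).1 *t g (mxtens_unindex k).2.

Definition choi_mx (R : realType) (d : nat) (g : 'I_d -> 'cV[R[i]]_d)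
    (S : 'End('M[R[i]]_d)) : 'M[R[i]]_(d * d) :=
  \matrix_(k, l) inner (tens_basis g k) (choi_op g S *m tens_basis g l).

(* The parameter q stands for e^{- Delta E / T}. *)
Definition qubit_choi (R : realType) (q lam r phi : R) : 'M[R[i]]_(2 * 2) :=
  \matrix_(k, l) nth 0 (nth [::]
    [:: [:: (1 - lam * q)%:C; 0; 0; r%:C * expi phi];
        [:: 0; (lam * q)%:C; 0; 0];
        [:: 0; 0; lam%:C; 0];
        [:: r%:C * expi (- phi); 0; 0; (1 - lam)%:C]] k) l.

(* The vectors g_1, g_2 of a basis of C^2 are g 0, g 1. *)
Definition dom_Psi (R : realType) (q : R) (g : 'I_2 -> 'cV[R[i]]_2) :
    set 'End('M[R[i]]_2) :=
  [set S | exists lam r phi : R,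
    [/\ 0 <= r, - pi <= phi < pi & choi_mx g S = qubit_choi q lam r phi]].

Definition Psi_fst (R : realType) (g : 'I_2 -> 'cV[R[i]]_2)
    (S : 'End('M[R[i]]_2)) : R[i] :=
  inner (g 0) (S (ketbra (g 1) (g 1)) *m g 0).

Definition Psi_snd (R : realType) (g : 'I_2 -> 'cV[R[i]]_2)
    (S : 'End('M[R[i]]_2)) : R[i] :=
  inner (g 0) (S (ketbra (g 0) (g 1)) *m g 1).

(* Psi_fst is real only on dom_Psi, hence the real part. *)
Definition Psi (R : realType) (g : 'I_2 -> 'cV[R[i]]_2)
    (S : 'End('M[R[i]]_2)) : R * R[i] :=
  (complex.Re (Psi_fst g S), Psi_snd g S).

Definition opT (R : realType) (q : R) (x y : R * R[i]) : R * R[i] :=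
  (x.1 + y.1 - x.1 * y.1 * (1 + q), x.2 * y.2).

(* Main.v *)
Require Import Defs.
From HB Require Import structures.
From mathcomp Require Import all_boot all_order all_algebra.
From mathcomp Require Import sesquilinear spectral complex mxtens.
From mathcomp Require Import all_classical all_reals all_analysis.
From mathcomp Require Import ring lra.
Import Order.TTheory GRing.Theory Num.Theory numFieldNormedType.Exports.
Local Open Scope ring_scope.
Local Open Scope complex_scope.
Local Open Scope classical_set_scope.

(** In the basis [g] everything is a matrix computation. Commutation with
    [ad HS] forces [S(|g_i><g_j|)] into the eigenspace of [ad HS] of eigenvalue
    [E_i - E_j], so in coordinates [S] acts on the diagonal by a 2x2 matrix and
    multiplies the two off-diagonal entries by scalars. Trace preservation and
    invariance of the Gibbs state leave a single free parameter [lam] in the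
    diagonal block, and positivity of the Choi matrix gives [0 <= lam <= 1], that
    the two scalars are conjugate, and the bound on their modulus [r] as a 2x2
    minor. Conversely, a Cholesky factorisation of the 2x2 block of the Choi
    matrix yields four explicit Kraus operators. Since [S] is determined by
    [(lam, c)], composing two maps of this form gives (b). *)

(** * Adjoints and positive semidefinite matrices *)

Section Adjoint.
Local Open Scope sesquilinear_scope.
Context {R : realType}.
Implicit Types m n p : nat.

Lemma adjmxK m n (A : 'M[R[i]]_(m, n)) : A^t*^t* = A.
Proof. by apply/matrixP => i j; rewrite !mxE conjCK. Qed.

Lemma adjmx_mul m n p (A : 'M[R[i]]_(m, n)) (B : 'M[R[i]]_(n, p)) :
  (A *m B)^t* = B^t* *m A^t*.
Proof. by rewrite trmx_mul map_mxM. Qed.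

Lemma adjmxD m n (A B : 'M[R[i]]_(m, n)) : (A + B)^t* = A^t* + B^t*.
Proof. by rewrite linearD map_mxD. Qed.

Lemma adjmxZ m n (a : R[i]) (A : 'M[R[i]]_(m, n)) :
  (a *: A)^t* = a^*%R *: A^t*.
Proof. by apply/matrixP => i j; rewrite !mxE rmorphM. Qed.

Lemma adjmx1 n : (1%:M : 'M[R[i]]_n)^t* = 1%:M.
Proof. by rewrite trmx1 map_mx1. Qed.

Lemma adjmx_tens m n p q (A : 'M[R[i]]_(m, n)) (B : 'M[R[i]]_(p, q)) :
  (A *t B)^t* = A^t* *t B^t*.
Proof. by rewrite trmx_tens map_mxT. Qed.

Lemma adjmx_delta m n (i : 'I_m) (j : 'I_n) :
  (delta_mx i j : 'M[R[i]]_(m, n))^t* = delta_mx j i.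
Proof. by rewrite trmx_delta map_delta_mx. Qed.

Lemma tens_delta_sumE n d (B : 'I_n -> 'I_n -> 'M[R[i]]_d) i j k l :
  (\sum_i \sum_j (delta_mx i j : 'M[R[i]]_n) *t B i j)
    (mxtens_index (i, k)) (mxtens_index (j, l)) = B i j k l.
Proof.
rewrite summxE (bigD1 i) //= summxE (bigD1 j) //= tensmxE.
rewrite big1 => [|j' ne]; last first.
  by rewrite tensmxE mxE eq_sym (negbTE ne) andbF mul0r.
rewrite big1 => [|i' ne]; last first.
  rewrite summxE big1 // => j' _.
  by rewrite tensmxE mxE eq_sym (negbTE ne) mul0r.
by rewrite mxE !eqxx mul1r !addr0.
Qed.

Lemma hermP n (A : 'M[R[i]]_n) : (A \is hermsymmx) <-> (A = A^t*).
Proof.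
split => [/is_hermitianmxP|AE]; first by rewrite expr0 scale1r.
by apply/is_hermitianmxP; rewrite expr0 scale1r.
Qed.

Lemma psdmx_conj m n (V : 'M[R[i]]_(m, n)) (A : 'M[R[i]]_n) :
  psdmx A -> psdmx (V *m A *m V^t*).
Proof.
move=> [/hermP AE A0]; split=> [|v].
  by apply/hermP; rewrite !adjmx_mul adjmxK -AE mulmxA.
have := A0 (V^t* *m v).
by rewrite /inner adjmx_mul adjmxK !mulmxA.
Qed.

Lemma psdmx0 n : psdmx (0 : 'M[R[i]]_n).
Proof.
split=> [|v]; last by rewrite /inner mul0mx mulmx0 mxE.
by apply/hermP; rewrite trmx0 map_mx0.
Qed.

Lemma psdmx1 n : psdmx (1%:M : 'M[R[i]]_n).
Proof.
split=> [|v]; first by apply/hermP; rewrite adjmx1.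
rewrite mul1mx /inner mxE sumr_ge0 // => i _.
by rewrite !mxE mulrC mul_conjC_ge0.
Qed.

Lemma psdmxD n (A B : 'M[R[i]]_n) : psdmx A -> psdmx B -> psdmx (A + B).
Proof.
move=> [/hermP AE A0] [/hermP BE B0]; split=> [|v].
  by apply/hermP; rewrite adjmxD -AE -BE.
have := addr_ge0 (A0 v) (B0 v).
by rewrite /inner mulmxDl mulmxDr [X in _ -> 0 <= X]mxE.
Qed.

Lemma psdmxZ n (a : R[i]) (A : 'M[R[i]]_n) :
  0 <= a -> psdmx A -> psdmx (a *: A).
Proof.
move=> a0 [/hermP AE A0]; split=> [|v].
  by apply/hermP; rewrite adjmxZ -AE geC0_conj.
by rewrite /inner -scalemxAl -scalemxAr mxE mulr_ge0 // A0.
Qed.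

Lemma psdmx_diag_ge0 n (A : 'M[R[i]]_n) i : psdmx A -> 0 <= A i i.
Proof.
move=> [_ /(_ (delta_mx i 0))].
by rewrite /inner adjmx_delta mulmxA -rowE -colE !mxE.
Qed.

(** The discriminant argument behind the 2x2 minor inequality, with [N] in the role of the squared
    modulus of the off-diagonal entry. *)
Lemma quad_minor (a b N : R) : 0 <= a ->
  (forall s, 0 <= s ^+ 2 * a - 2 * s * N + N * b) -> 0 <= b -> 0 <= N ->
  N <= a * b.
Proof.
move=> a0 H b0 N0; have [a_eq0|an] := eqVneq a 0.
  (* Without its square term the form is affine in [s]; at [s = b + 1] it equals [- (b + 2) * N],
     which forces [N <= 0]. *)
  by have := H (b + 1); rewrite a_eq0 mulr0 mul0r => Hb; nra.
have a1 : 0 < a by rewrite lt_def an.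
(* [N / a] is the point where the quadratic is minimal. *)
have := H (N / a).
have -> : (N / a) ^+ 2 * a - 2 * (N / a) * N + N * b = N * (a * b - N) / a.
  by field.
rewrite pmulr_lge0 ?invr_gt0 //; have := mulr_ge0 a0 b0.
by move: (a * b) => M; nra.
Qed.

Lemma psdmx_minor n (A : 'M[R[i]]_n) i j : psdmx A ->
  `|A i j| ^+ 2 <= A i i * A j j.
Proof.
move=> Apsd; have := psdmx_diag_ge0 _ _ i Apsd; have := psdmx_diag_ge0 _ _ j Apsd.
case: Apsd => /hermP AE A0.
have AC : A j i = (A i j)^*%R by rewrite {1}AE !mxE.
have H x y : 0 <= x^*%R * x * A i i + x^*%R * y * A i j
    + y^*%R * x * (A i j)^*%R + y^*%R * y * A j j.
  have := A0 (x *: delta_mx i 0 + y *: delta_mx j 0); congr (0 <= _).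
  pose B (u v : 'cV[R[i]]_n) := inner u (A *m v); rewrite -/(B _ _).
  have Bl u u' v : B (x *: u + y *: u') v = x^*%R * B u v + y^*%R * B u' v.
    rewrite /B; move: (A *m v) => w.
    by rewrite /inner adjmxD !adjmxZ mulmxDl -!scalemxAl !mxE.
  have Br u v v' : B u (x *: v + y *: v') = x * B u v + y * B u v'.
    by rewrite /B mulmxDr -!scalemxAr /inner mulmxDr -!scalemxAr !mxE.
  have Bd k l : B (delta_mx k 0) (delta_mx l 0) = A k l.
    by rewrite /B /inner adjmx_delta mulmxA -rowE -colE !mxE.
  by rewrite Bl !Br !Bd AC; ring.
(* The second coefficient has the phase that makes both cross terms equal to [- s * N] with [N] the
   squared modulus of [A i j], which leaves the real quadratic of [quad_minor]. *)
have {H} := fun s : R => H s%:C (- (A i j)^*%R).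
clear A0 AE AC.
move: (A i i) (A j j) (A i j) => [a a'] [b b'] [c d].
have conjE (x y : R) : Num.conj (x +i* y) = x -i* y by [].
rewrite normCK conjE !lecE /= => H /andP[/eqP a'0 a0] /andP[/eqP b'0 b0].
rewrite {}b'0 {}a'0 in H *; simpc; apply/andP; split; first by apply/eqP; ring.
apply: quad_minor => //; last by nra.
move=> s; have := H s; simpc => /= /andP[_]; lra. 
Qed.
End Adjoint.

(** * Coordinates in an orthonormal basis, Choi matrices and complete positivity *)

Section Coordinates.
Local Open Scope sesquilinear_scope.
Context {R : realType} {d : nat}.
Variable g : 'I_d -> 'cV[R[i]]_d.
Hypothesis g_basis : orthonormal_basis g.

Definition basis_mx : 'M[R[i]]_d := \matrix_(a, i) g i a 0.
Local Notation U := basis_mx.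

Definition mxcoord (A : 'M[R[i]]_d) : 'M[R[i]]_d := U^t* *m A *m U.

Lemma mxcoordE A k l : mxcoord A k l = inner (g k) (A *m g l).
Proof.
have colU i : col i U = g i by apply/matrixP => a b; rewrite !mxE ord1.
rewrite /mxcoord /inner -[in RHS](colU k) -[in RHS](colU l) -mulmxA colE.
by rewrite colE adjmx_mul adjmx_delta !mulmxA -rowE -colE -!row_mul !mxE.
Qed.

Lemma basis_mx_unitaryl : U^t* *m U = 1%:M.
Proof.
apply/matrixP => i j; rewrite -[U^t*]mulmx1 -/(mxcoord _) mxcoordE mul1mx.
by rewrite g_basis mxE.
Qed.

Lemma basis_mx_unitaryr : U *m U^t* = 1%:M.
Proof. exact: mulmx1C basis_mx_unitaryl. Qed.

Lemma mxcoord_is_linear : linear mxcoord.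
Proof.
by move=> a A B; rewrite /mxcoord mulmxDr mulmxDl -scalemxAr -scalemxAl.
Qed.
HB.instance Definition _ :=
  GRing.isLinear.Build R[i] 'M[R[i]]_d 'M[R[i]]_d _ mxcoord mxcoord_is_linear.

Definition of_mxcoord (Y : 'M[R[i]]_d) : 'M[R[i]]_d := U *m Y *m U^t*.

Lemma mxcoordK : cancel mxcoord of_mxcoord.
Proof.
move=> A; rewrite /of_mxcoord /mxcoord !mulmxA basis_mx_unitaryr mul1mx.
by rewrite -mulmxA basis_mx_unitaryr mulmx1.
Qed.

Lemma of_mxcoordK : cancel of_mxcoord mxcoord.
Proof.
move=> A; rewrite /of_mxcoord /mxcoord !mulmxA basis_mx_unitaryl mul1mx.
by rewrite -mulmxA basis_mx_unitaryl mulmx1.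
Qed.

Lemma mxcoord_inj : injective mxcoord.
Proof. exact: can_inj mxcoordK. Qed.

Lemma mxcoordM A B : mxcoord (A *m B) = mxcoord A *m mxcoord B.
Proof.
by rewrite /mxcoord !mulmxA -[_ *m U *m U^t*]mulmxA basis_mx_unitaryr mulmx1.
Qed.

Lemma mxcoord1 : mxcoord 1%:M = 1%:M.
Proof. by rewrite /mxcoord mulmx1 basis_mx_unitaryl. Qed.

Lemma mxcoord_adj A : mxcoord (A^t*) = (mxcoord A)^t*.
Proof. by rewrite /mxcoord !adjmx_mul adjmxK mulmxA. Qed.

Lemma mxcoord_tr A : \tr (mxcoord A) = \tr A.
Proof. by rewrite /mxcoord mxtrace_mulC mulmxA basis_mx_unitaryr mul1mx. Qed.

Lemma mxcoord_ketbra i j : mxcoord (ketbra (g i) (g j)) = delta_mx i j.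
Proof.
have E k : U^t* *m g k = delta_mx k 0.
  have {1}-> : g k = col k U by apply/matrixP => a b; rewrite !mxE ord1.
  by rewrite colE mulmxA basis_mx_unitaryl mul1mx.
have E' : (g j)^t* *m U = delta_mx 0 j.
  by rewrite -(adjmxK _ _ U) -adjmx_mul E adjmx_delta.
by rewrite /mxcoord /ketbra mulmxA E -mulmxA E' mul_delta_mx.
Qed.

Lemma ketbra_expansion A :
  A = \sum_i \sum_j mxcoord A i j *: ketbra (g i) (g j).
Proof.
apply: mxcoord_inj; rewrite {1}[mxcoord A]matrix_sum_delta linear_sum.
apply: eq_bigr => i _; rewrite linear_sum; apply: eq_bigr => j _.
by rewrite linearZ /= mxcoord_ketbra.
Qed.

(** Passing to the product basis acts on each tensor factor separately, and in the first factor it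
    turns [ketbra (g i) (g j)] into a matrix unit. *)
Lemma choi_mxE (S : 'End('M[R[i]]_d)) :
  choi_mx g S = \sum_i \sum_j
    (delta_mx i j : 'M[R[i]]_d) *t mxcoord (S (ketbra (g i) (g j))).
Proof.
apply/matrixP => k l; rewrite mxE.
case: (mxtens_indexP k) => k1 k2; case: (mxtens_indexP l) => l1 l2.
rewrite /tens_basis !mxtens_indexK /choi_op /inner /=.
rewrite mulmx_suml mulmx_sumr !summxE; apply: eq_bigr => i _.
rewrite mulmx_suml mulmx_sumr !summxE; apply: eq_bigr => j _.
have E (k' l' : 'I_d) A B : ((g k1 *t g k2)^t* *m ((A *t B) *m (g l1 *t g l2))) 0 0 =
    mxcoord A k1 l1 * mxcoord B k2 l2.
  rewrite adjmx_tens !tensmx_mul !mxcoordE /inner.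
  (* The only index of a product of 1x1 matrices has to be displayed as a pair before [tensmxE]
     applies. *)
  have E0 : (0 : 'I_1) = @mxtens_index 1 1 (0, 0) by exact: val_inj.
  by rewrite [in LHS]E0 tensmxE.
by rewrite E // mxcoord_ketbra tensmxE.
Qed.

Lemma choi_mx_coef (S : 'End('M[R[i]]_d)) i j k l :
  choi_mx g S (mxtens_index (i, k)) (mxtens_index (j, l)) =
  mxcoord (S (ketbra (g i) (g j))) k l.
Proof.
by rewrite choi_mxE tens_delta_sumE.
Qed.

Lemma mxtens_block_sum n (X : 'M[R[i]]_(n * d)) :
  X = \sum_i \sum_j (delta_mx i j : 'M[R[i]]_n) *t mxtens_block X i j.
Proof.
apply/matrixP => k l.
case: (mxtens_indexP k) => k1 k2; case: (mxtens_indexP l) => l1 l2.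
by rewrite tens_delta_sumE mxE.
Qed.

(** Each Kraus term turns into a congruence of [X] by the identity tensored with [K m], and
    congruences preserve positivity. Keeping the weights [p] outside the operators avoids square
    roots. *)
Lemma kraus_completely_positive n (p : 'I_n -> R[i]) (K : 'I_n -> 'M[R[i]]_d)
    (S : 'End('M[R[i]]_d)) :
  (forall m, 0 <= p m) ->
  (forall X, S X = \sum_m p m *: (K m *m X *m (K m)^t*)) ->
  completely_positive S.
Proof.
move=> p0 SE N X Xpsd.
have -> : ampliation S X = \sum_m p m *:
    (((1%:M : 'M[R[i]]_N) *t K m) *m X *m ((1%:M : 'M[R[i]]_N) *t K m)^t*).
  rewrite /ampliation.
  transitivity (\sum_m \sum_i \sum_j (p m *: ((delta_mx i j : 'M[R[i]]_N) *t
      (K m *m mxtens_block X i j *m (K m)^t*)))).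
    rewrite [RHS]exchange_big; apply: eq_bigr => i _.
    rewrite [RHS]exchange_big; apply: eq_bigr => j _.
    rewrite SE; apply/matrixP => k l; rewrite mxE !summxE mulr_sumr.
    by apply: eq_bigr => m _; rewrite !mxE mulrCA.
  apply: eq_bigr => m _; rewrite [in RHS](mxtens_block_sum _ X).
  rewrite mulmx_sumr mulmx_suml scaler_sumr; apply: eq_bigr => i _.
  rewrite mulmx_sumr mulmx_suml scaler_sumr; apply: eq_bigr => j _.
  by rewrite adjmx_tens adjmx1 !tensmx_mul mul1mx mulmx1.
elim/big_ind: _ => [||m _]; [exact: psdmx0|exact: psdmxD|].
exact/psdmxZ/psdmx_conj.
Qed.

(** The easy half of Choi's theorem: [V] is an unnormalised maximally entangled vector, the blocks
    of its projector are the [ketbra (g i) (g j)], and a congruence by the identity tensored with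
    the adjoint of [basis_mx g] moves the ampliated projector to the Choi matrix. *)
Lemma completely_positive_choi (S : 'End('M[R[i]]_d)) :
  completely_positive S -> psdmx (choi_mx g S).
Proof.
move=> S_cp.
pose V : 'cV[R[i]]_(d * d) := \sum_i (delta_mx i 0 : 'cV[R[i]]_d) *t g i.
have tensE (u v : 'cV[R[i]]_d) i k :
    (u *t v : 'cV_(d * d)) (mxtens_index (i, k)) 0 = u i 0 * v k 0.
  rewrite -(tensmxE u v) /=; congr fun_of_matrix; exact: val_inj.
have VE i k : V (mxtens_index (i, k)) 0 = g i k 0.
  rewrite summxE (bigD1 i) // big1 => [|j ne]; rewrite tensE mxE.
    by rewrite !eqxx mul1r /= addr0.
  by rewrite eq_sym (negbTE ne) mul0r.
have := S_cp d _ (psdmx_conj _ _ V _ (psdmx1 _)).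
rewrite mulmx1; set X := V *m _ => X_psd.
have XE i j : mxtens_block X i j = ketbra (g i) (g j).
  by apply/matrixP => k l; rewrite !mxE !big_ord1 !mxE !VE.
have := psdmx_conj _ _ ((1%:M : 'M[R[i]]_d) *t U^t*) _ X_psd.
congr psdmx; rewrite choi_mxE /ampliation mulmx_sumr mulmx_suml.
apply: eq_bigr => i _; rewrite mulmx_sumr mulmx_suml; apply: eq_bigr => j _.
by rewrite XE adjmx_tens adjmx1 adjmxK !tensmx_mul mul1mx mulmx1.
Qed.
End Coordinates.

(** * The exponential of a matrix that is diagonal in the basis *)

Section Exponential.
Context {R : realType}.

Lemma cvg_real_complex (u : nat -> R) (l : R) :
  u n @[n --> \oo] --> l ->
  ((u n)%:C : R[i]^o) @[n --> \oo] --> (l%:C : R[i]^o).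
Proof.
move=> /cvgrPdist_lt ul; apply/cvgrPdist_lt => -[e e'].
rewrite ltcE /= => /andP[/eqP -> e0].
have := ul e e0; apply: filterS => n.
by rewrite -rmorphB normc_def /= expr0n addr0 sqrtr_sqr ltcR.
Qed.

Context {d : nat} (g : 'I_d -> 'cV[R[i]]_d).
Hypothesis g_basis : orthonormal_basis g.

(** In coordinates these are powers of a diagonal matrix; the case [k = 0] is the resolution of the
    identity. *)
Lemma expmx_spectral (x : 'I_d -> R[i]) k :
  (\sum_i x i *: ketbra (g i) (g i)) ^+ k =
  \sum_i x i ^+ k *: ketbra (g i) (g i).
Proof.
have E y : mxcoord g (\sum_i y i *: ketbra (g i) (g i)) = diag_mx (\row_i y i).
  rewrite linear_sum /= [RHS]diag_mx_sum_delta; apply: eq_bigr => i _.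
  by rewrite linearZ /= mxcoord_ketbra // mxE.
apply: (mxcoord_inj g g_basis); rewrite E.
elim: k => [|k IH].
  rewrite expr0 [LHS]mxcoord1 //; apply/matrixP => i j.
  by rewrite !mxE.
rewrite exprS [LHS]mxcoordM // IH E mulmx_diag; congr diag_mx.
by apply/matrixP => i j; rewrite !mxE exprS.
Qed.

Lemma mxexp_spectral (x : 'I_d -> R) :
  mxexp (\sum_i (x i)%:C *: ketbra (g i) (g i)) =
  \sum_i (expR (x i))%:C *: ketbra (g i) (g i).
Proof.
rewrite /mxexp; apply: (@cvg_lim _ (@norm_hausdorff _ 'M[R[i]^o]_d)).
(* The partial sums split into one scalar exponential series per eigenvalue, so that convergence is
   reduced to that of [expR]. *)
rewrite (_ : series _ = fun n => \sum_i
    (series (exp_coeff (x i)) n)%:C *: ketbra (g i) (g i)); last first.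
  apply/funext => n; rewrite /series /= [RHS](eq_bigr (fun i =>
    \sum_(0 <= k < n) (k`!%:R)^-1 *: ((x i)%:C ^+ k *: ketbra (g i) (g i)))).
    rewrite exchange_big; apply: eq_bigr => k _ /=.
    by rewrite expmx_spectral scaler_sumr.
  move=> i _; rewrite rmorph_sum scaler_suml; apply: eq_bigr => k _.
  by rewrite /exp_coeff /= scalerA rmorphM rmorphXn fmorphV rmorph_nat mulrC.
apply: cvg_big => [|i _]; first exact: add_continuous.
apply: (@cvgZr_tmp _ 'M[R[i]^o]_d).
apply: cvg_real_complex.
exact: is_cvg_series_exp_coeff.
Qed.
End Exponential.

(** * Polar form of complex numbers, and indices of a two-level system *)

Lemma polar_decomposition {R : realType} (z : R[i]) :
  exists r phi : R, [/\ 0 <= r, - pi <= phi < pi & z = r%:C * expi phi].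
Proof.
have pi0 : 0 < pi :> R := pi_gt0 R.
have [->|z0] := eqVneq z 0.
  by exists 0, 0; split; rewrite ?mul0r // pi0 oppr_le0 ltW.
case: z z0 => a b ab0.
set r := Num.sqrt (a ^+ 2 + b ^+ 2).
have r0 : 0 < r.
  rewrite sqrtr_gt0 lt_def addr_ge0 ?sqr_ge0 // andbT.
  by rewrite paddr_eq0 ?sqr_ge0 // !sqrf_eq0; move: ab0; rewrite eq_complex.
have r2 : r ^+ 2 = a ^+ 2 + b ^+ 2 by rewrite sqr_sqrtr // addr_ge0 ?sqr_ge0.
pose x := a / r; pose y := b / r.
have xy1 : x ^+ 2 + y ^+ 2 = 1.
  by rewrite /x /y !expr_div_n -mulrDl -r2 mulfV // expf_neq0 // gt_eqF.
have aE : a = r * x by rewrite /x mulrC divfK // gt_eqF.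
have bE : b = r * y by rewrite /y mulrC divfK // gt_eqF.
have x1 : -1 <= x <= 1 by apply/andP; split; nra.
have ys : Num.sqrt (1 - x ^+ 2) = `|y|.
  by rewrite -sqrtr_sqr; congr Num.sqrt; lra.
(* [acos] takes values between [0] and [pi], so the sign of [y] selects the half circle. The case
   [y = 0] belongs to the lower one, since the negative real axis must get the angle [- pi] and not
   [pi]. *)
exists r; have [y0|y0] := lerP y 0.
  exists (- acos x); split; first exact: ltW.
    by rewrite lerN2 acos_lepi //= ltrNl (lt_le_trans _ (acos_ge0 x1)) // oppr_lt0.
  rewrite /expi cosN sinN sin_acos // acosK // ys ler0_norm // opprK.
  by simpc; rewrite -aE -bE.
exists (acos x); split; first exact: ltW.
  rewrite (le_trans _ (acos_ge0 x1)) ?oppr_le0 ?ltW //=.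
  by apply: acos_ltpi; case/andP: x1 => _ ->; rewrite andbT; nra.
rewrite /expi sin_acos // acosK // ys gtr0_norm //.
by simpc; rewrite -aE -bE.
Qed.

Lemma conj_expi {R : realType} (phi : R) : (expi phi)^*%R = expi (- phi).
Proof. by rewrite /expi cosN sinN. Qed.

Lemma normc_polar {R : realType} (r phi : R) :
  `|r%:C * expi phi| ^+ 2 = (r ^+ 2)%:C.
Proof.
rewrite normrM exprMn /expi [`|cos _ +i* _|]normc_def /= cos2Dsin2 sqrtr1 expr1n.
rewrite mulr1 normc_def /= expr0n addr0 sqrtr_sqr -rmorphXn; congr _%:C.
by rewrite real_normK ?num_real.
Qed.

Lemma ord2P (P : 'I_2 -> Prop) : P 0 -> P 1 -> forall i, P i.
Proof.
by move=> P0 P1 [[|[|//]] ilt]; [move: P0|move: P1]; congr P; apply: val_inj.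
Qed.

Lemma sum_ord2 {V : nmodType} (F : 'I_2 -> V) : \sum_i F i = F 0 + F 1.
Proof.
rewrite !big_ord_recl big_ord0 addr0.
by congr (F _ + F _); exact: val_inj.
Qed.

(** The gaps are [0], [E2 - E1] and [E1 - E2], which are distinct, and only the gap [0] is attained
    by two pairs. This tells which coefficients survive commutation with [ad HS]. *)
Lemma level_gap {R : realType} (E1 E2 : R) (i j k l : 'I_2) :
  let E (m : 'I_2) := if m == 0 then E1 else E2 in
  E1 < E2 -> E i - E j = E k - E l ->
  (i == j) && (k == l) || (i == k) && (j == l).
Proof.
move=> E lt12; rewrite /E.
by move: i j k l; elim/ord2P; elim/ord2P; elim/ord2P; elim/ord2P => //= ?; lra.
Qed.

(** * Qubit maps in coordinates: composition, parameters and Kraus operators *)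

Section Qubit.
Local Open Scope sesquilinear_scope.
Context {R : realType}.
Implicit Types (q lam r phi : R) (c : R[i]) (Y : 'M[R[i]]_2).

(** The action on coordinates encoded by [qubit_choi], with the polar pair [r], [phi] merged into
    the complex number [c]. *)
Definition qubit_map q lam c Y : 'M[R[i]]_2 := \matrix_(k, l)
  if k == l then
    if k == 0 then (1 - lam * q)%:C * Y 0 0 + lam%:C * Y 1 1
    else (lam * q)%:C * Y 0 0 + (1 - lam)%:C * Y 1 1
  else if k == 0 then c * Y 0 1 else c^*%R * Y 1 0.

Variable g : 'I_2 -> 'cV[R[i]]_2.
Hypothesis g_basis : orthonormal_basis g.

Lemma qubit_mapP q lam c (S : 'End('M[R[i]]_2)) :
  (forall i j, mxcoord g (S (ketbra (g i) (g j))) =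
               qubit_map q lam c (delta_mx i j)) ->
  forall X, mxcoord g (S X) = qubit_map q lam c (mxcoord g X).
Proof.
move=> H X; have -> : mxcoord g (S X) =
    \sum_i \sum_j mxcoord g X i j *: qubit_map q lam c (delta_mx i j).
  rewrite {1}(ketbra_expansion g g_basis X) linear_sum linear_sum.
  apply: eq_bigr => i _; rewrite linear_sum linear_sum.
  by apply: eq_bigr => j _; rewrite linearZ /= linearZ /= H.
move: (mxcoord g X) => Y; rewrite !sum_ord2.
by apply/matrixP; elim/ord2P; elim/ord2P; rewrite !mxE /=; ring.
Qed.

(** The Choi entries are the coefficients of the images of the matrix units, which determine [S] by
    linearity. *)
Lemma choi_qubitP q lam r phi (S : 'End('M[R[i]]_2)) :
  choi_mx g S = qubit_choi q lam r phi <->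
  (forall X, mxcoord g (S X) =
             qubit_map q lam (r%:C * expi phi) (mxcoord g X)).
Proof.
have cE : (r%:C * expi phi)^*%R = r%:C * expi (- phi).
  by rewrite -conj_expi rmorphM; congr (_ * _); exact: conjc_real.
have coefE i j k l : qubit_choi q lam r phi (mxtens_index (i, k)) (mxtens_index (j, l))
    = qubit_map q lam (r%:C * expi phi) (delta_mx i j) k l.
  rewrite /qubit_choi /qubit_map mxE mxE cE !mxE.
  move: i j k l; elim/ord2P; elim/ord2P; elim/ord2P; elim/ord2P => /=;
    by rewrite ?mulr0 ?mulr1 ?addr0 ?add0r.
split=> [SE|SE].
  apply: qubit_mapP => i j; apply/matrixP => k l.
  by rewrite -coefE -SE choi_mx_coef.
apply/matrixP => k l.
case: (mxtens_indexP k) => k1 k2; case: (mxtens_indexP l) => l1 l2.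
by rewrite choi_mx_coef // SE mxcoord_ketbra // coefE.
Qed.

(** On the diagonal the map is [1 + lam * N] with [N] having rows [(- q, 1)] and [(q, - 1)]; since
    [N ^+ 2 = - (1 + q) * N], the composition law of the parameters follows. *)
Lemma qubit_map_comp q lam1 c1 lam2 c2 Y :
  qubit_map q lam1 c1 (qubit_map q lam2 c2 Y) =
  qubit_map q (lam1 + lam2 - lam1 * lam2 * (1 + q)) (c1 * c2) Y.
Proof.
apply/matrixP; elim/ord2P; elim/ord2P; rewrite !mxE /= ?rmorphM ?rmorphB /=;
  rewrite ?rmorphD ?rmorphB ?rmorphM /= ?rmorphD ?rmorph1; ring.
Qed.

Lemma Psi_qubit q lam c (S : 'End('M[R[i]]_2)) :
  (forall X, mxcoord g (S X) = qubit_map q lam c (mxcoord g X)) ->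
  Psi_fst g S = lam%:C /\ Psi g S = (lam, c).
Proof.
move=> SE.
have E1 : Psi_fst g S = lam%:C.
  by rewrite /Psi_fst -mxcoordE SE mxcoord_ketbra // !mxE /= mulr0 mulr1 add0r.
split=> //; rewrite /Psi E1 /Psi_snd -mxcoordE SE mxcoord_ketbra // !mxE /=.
by rewrite mulr1.
Qed.

(** Every complex number has a polar form, so the constraints on [r] and [phi] leave [c] free;
    closure under composition is then visible. *)
Lemma dom_PsiP q (S : 'End('M[R[i]]_2)) :
  dom_Psi q g S <-> exists lam c,
    forall X, mxcoord g (S X) = qubit_map q lam c (mxcoord g X).
Proof.
split=> [[lam [r [phi [_ _ /choi_qubitP SE]]]]|[lam [c]]].
  by exists lam, (r%:C * expi phi).
have [r [phi [r0 phi_b ->]]] := polar_decomposition c.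
by move=> /choi_qubitP SE; exists lam, r, phi.
Qed.

Lemma qubit_map_tr q lam c Y : \tr (qubit_map q lam c Y) = \tr Y.
Proof.
rewrite /mxtrace !sum_ord2 !mxE /= !rmorphB rmorph1.
ring.
Qed.

Lemma ad_diag (e : 'rV[R[i]]_2) Y k l :
  ad (diag_mx e) Y k l = (e 0 k - e 0 l) * Y k l.
Proof. by rewrite /ad mul_diag_mx mul_mx_diag !mxE; ring. Qed.

Lemma qubit_map_ad q lam c (e : 'rV[R[i]]_2) Y :
  qubit_map q lam c (ad (diag_mx e) Y) = ad (diag_mx e) (qubit_map q lam c Y).
Proof.
apply/matrixP; elim/ord2P; elim/ord2P;
  rewrite [RHS]ad_diag [LHS]mxE /= !ad_diag mxE /=; ring.
Qed.

Lemma qubit_map_gibbs q lam c (e : 'rV[R[i]]_2) :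
  e 0 1 = q%:C * e 0 0 -> qubit_map q lam c (diag_mx e) = diag_mx e.
Proof.
move=> eE; apply/matrixP; elim/ord2P; elim/ord2P;
  by rewrite !mxE /= ?eqxx ?mulr0n ?mulr1n ?eE ?rmorphB ?rmorphM ?rmorph1; ring.
Qed.

Lemma mulmx_delta_sandwich Y i j (k : 'I_2) :
  (delta_mx k i : 'M[R[i]]_2) *m Y *m delta_mx j k = Y i j *: delta_mx k k.
Proof.
rewrite -(mul_delta_mx (0 : 'I_1) k i) -(mul_delta_mx (0 : 'I_1) j k) mulmxA.
rewrite -2!(mulmxA (delta_mx k 0)) -rowE -colE [col _ _]mx11_scalar !mxE.
by rewrite mul_mx_scalar -scalemxAl mul_delta_mx.
Qed.

(** The bound on the modulus of [c] says that the second pivot [1 - lam - N / a] of the Cholesky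
    factorisation is nonnegative. *)
Lemma qubit_completely_positive q lam c (S : 'End('M[R[i]]_2)) :
  0 <= lam <= 1 -> 0 <= q <= 1 ->
  `|c| ^+ 2 <= ((1 - lam) * (1 - lam * q))%:C ->
  (forall X, mxcoord g (S X) = qubit_map q lam c (mxcoord g X)) ->
  completely_positive S.
Proof.
move=> /andP[lam0 lam1] /andP[q0 q1] c_le SE.
have lamq0 : 0 <= lam * q by rewrite mulr_ge0.
have lamq1 : lam * q <= 1 by rewrite mulr_ile1.
pose a := 1 - lam * q.
pose N := complex.Re c ^+ 2 + complex.Im c ^+ 2.
have NE : N%:C = c * c^*%R by rewrite add_Re2_Im2 normCK.
have N_le : N <= (1 - lam) * a by rewrite -lecR add_Re2_Im2.
(* When [a = 0], also [c = 0], so the junk value [c / 0 = 0] is the right one. *)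
pose p : 'I_4 -> R := fun m => nth 0
  [:: lam * q; lam; a; 1 - lam - N / a] m.
pose u := c / a%:C.
have auE : a%:C * u = c.
  rewrite /u; have [a0|an0] := eqVneq a 0; last first.
    by rewrite mulrC divfK // (inj_eq (@complexI R) a 0).
  have N0 : N = 0.
    by apply: le_anti; rewrite (le_trans N_le) ?a0 ?mulr0 // addr_ge0 ?sqr_ge0.
  by apply/eqP; rewrite a0 mul0r eq_sym -mul_conjC_eq0 -NE N0.
have auuE : a%:C * (u * u^*%R) = (N / a)%:C.
  have -> : u^*%R = c^*%R / a%:C.
    rewrite /u [LHS]fmorph_div; congr (_ / _); exact: conjc_real.
  by rewrite mulrA auE mulrA -NE rmorphM fmorphV.
pose e : 'rV[R[i]]_2 := \row_i if i == 0 then 1 else u^*%R.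
(* In the order of the weights [p]: the two jumps between the levels, the diagonal operator that
   carries the coherence [c], and the remaining population of the second level. *)
pose K : 'I_4 -> 'M[R[i]]_2 := fun m => nth 0
  [:: delta_mx 1 0; delta_mx 0 1; diag_mx e; delta_mx 1 1] m.
apply: (@kraus_completely_positive _ _ 4 (fun m => (p m)%:C)
  (fun m => of_mxcoord g (K m))) => [m|X].
  rewrite ler0c; case: m => -[|[|[|[|//]]]] ? //=; rewrite ?subr_ge0 //.
  have [a0|an0] := eqVneq a 0; first by rewrite a0 invr0 mulr0 subr_ge0.
  by rewrite ler_pdivrMr // lt_def an0 subr_ge0.
apply: (mxcoord_inj g g_basis); rewrite SE linear_sum /=.
rewrite (eq_bigr (fun m => (p m)%:C *: (K m *m mxcoord g X *m (K m)^t*)));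
  last first.
  by move=> m _; rewrite linearZ /= 
    (mxcoordM g g_basis (_ *m X)) (mxcoordM g g_basis _ X) mxcoord_adj of_mxcoordK.
rewrite !big_ord_recl big_ord0 addr0 /p /K /=.
move: (mxcoord g X) => Y.

rewrite !adjmx_delta !mulmx_delta_sandwich tr_diag_mx map_diag_mx.
rewrite mul_diag_mx mul_mx_diag.
apply/matrixP; elim/ord2P; elim/ord2P; rewrite !mxE /= ?rmorph1 ?conjCK.
- by rewrite -/a; ring.
- by rewrite -auE; ring.
- by rewrite -auE rmorphM /= [(a%:C)^*%R]conjc_real; ring.
- by rewrite [(1 - lam - N / a)%:C]rmorphB /= -auuE; ring.
Qed.

Lemma mxcoord_ad A X :
  mxcoord g (ad A X) = ad (mxcoord g A) (mxcoord g X).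
Proof. by rewrite /ad linearB /= !mxcoordM. Qed.

Lemma ad_diag_ketbra (e : 'rV[R[i]]_2) A i j : mxcoord g A = diag_mx e ->
  ad A (ketbra (g i) (g j)) = (e 0 i - e 0 j) *: ketbra (g i) (g j).
Proof.
move=> AE; apply: (mxcoord_inj g g_basis).
rewrite mxcoord_ad AE linearZ /= mxcoord_ketbra //.
apply/matrixP => k l; rewrite ad_diag !mxE.
by case: eqP => [->|]; case: eqP => [->|]; rewrite ?mulr0.
Qed.

(** * Enhanced thermal operations as qubit maps *)

Section Thermal.
Variables (E1 E2 : R) (HS : 'M[R[i]]_2) (T : \bar R).
Hypothesis HS_spec :
  HS = E1%:C *: ketbra (g 0) (g 0) + E2%:C *: ketbra (g 1) (g 1).
Hypothesis ltE : E1 < E2.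
Hypothesis T_gt0 : (0 < T)%E.
Let q := boltzmann (E2 - E1) T.

Lemma boltzmann_gt0 : 0 < q.
Proof. by rewrite /q; case: T => *; rewrite /= ?expR_gt0. Qed.

Lemma boltzmann_le1 : q <= 1.
Proof.
rewrite /q; case: T T_gt0 => [t|_|//] //=; rewrite lte_fin => t0.
by rewrite -expR0 ler_expR mulNr oppr_le0 divr_ge0 ?subr_ge0 // ltW.
Qed.

Lemma mxcoord_diag (x : 'rV[R[i]]_2) :
  mxcoord g (x 0 0 *: ketbra (g 0) (g 0) + x 0 1 *: ketbra (g 1) (g 1)) =
  diag_mx x.
Proof.
rewrite linearD !linearZ /= !mxcoord_ketbra //.
apply/matrixP; elim/ord2P; elim/ord2P; rewrite !mxE /=;
  by rewrite ?mulr0 ?mulr1 ?addr0 ?add0r.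
Qed.

Definition energies : 'rV[R[i]]_2 := \row_i (if i == 0 then E1 else E2)%:C.

Lemma mxcoord_hamiltonian : mxcoord g HS = diag_mx energies.
Proof. by rewrite HS_spec -mxcoord_diag !mxE. Qed.

(** Treats finite and infinite temperature alike: [G] is the unnormalised Gibbs state, or the
    identity with [q = 1], and in both cases its two weights have ratio [q]. *)
Lemma gibbs_state : exists (G : 'M[R[i]]_2) (w : 'rV[R[i]]_2),
  [/\ w 0 0 != 0, w 0 1 = q%:C * w 0 0, mxcoord g G = diag_mx w
    & forall S, gibbs_preserving HS T S <-> S G = G].
Proof.
rewrite /q; case: T T_gt0 => [t|_|//]; last first.
  exists 1%:M, (const_mx 1); split=> //; rewrite ?mxE ?oner_eq0 ?mulr1 //.
  by rewrite mxcoord1 // diag_const_mx.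
rewrite lte_fin => t0; pose x (i : 'I_2) := - (if i == 0 then E1 else E2) / t.
exists (mxexp (- (t^-1)%:C *: HS)), (\row_i (expR (x i))%:C).
rewrite /gibbs_preserving.
have -> : - (t^-1)%:C *: HS = \sum_i (x i)%:C *: ketbra (g i) (g i).
  rewrite sum_ord2 HS_spec scalerDr !scalerA /x /=.
  by rewrite !mulNr -!rmorphM /= !rmorphN /= ![t^-1 * _]mulrC.
rewrite mxexp_spectral // sum_ord2; split=> //.
- by rewrite mxE (inj_eq (@complexI R) _ 0) gt_eqF // expR_gt0.
- rewrite !mxE -rmorphM /= -expRD /x /=; congr (expR _)%:C.
  by field; rewrite gt_eqF.
- by rewrite -mxcoord_diag !mxE.
Qed.

Lemma qubit_EnTO lam c (S : 'End('M[R[i]]_2)) :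
  0 <= lam <= 1 -> `|c| ^+ 2 <= ((1 - lam) * (1 - lam * q))%:C ->
  (forall X, mxcoord g (S X) = qubit_map q lam c (mxcoord g X)) ->
  EnTO HS T S.
Proof.
move=> lam01 c_le SE; split.
- apply: (qubit_completely_positive q lam c) => //.
  by rewrite boltzmann_le1 ltW // boltzmann_gt0.
- by move=> X; rewrite -[LHS](mxcoord_tr g g_basis) SE qubit_map_tr mxcoord_tr.
- have [G [w [_ wE GE ->]]] := gibbs_state.
  by apply: (mxcoord_inj g g_basis); rewrite SE GE qubit_map_gibbs.
- move=> X; apply: (mxcoord_inj g g_basis).
  by rewrite SE !mxcoord_ad SE mxcoord_hamiltonian qubit_map_ad.
Qed.

Lemma EnTO_qubit (S : 'End('M[R[i]]_2)) : EnTO HS T S ->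
  exists lam c, [/\ 0 <= lam <= 1,
    `|c| ^+ 2 <= ((1 - lam) * (1 - lam * q))%:C
    & forall X, mxcoord g (S X) = qubit_map q lam c (mxcoord g X)].
Proof.
move=> [S_cp S_tp S_gibbs S_ad].
pose M i j := mxcoord g (S (ketbra (g i) (g j))).
have M_choi i j k l : choi_mx g S (mxtens_index (i, k)) (mxtens_index (j, l)) = M i j k l.
  exact: choi_mx_coef.
have choi_psd := completely_positive_choi g g_basis _ S_cp.
have M_ge0 i k : 0 <= M i i k k.
  by rewrite -M_choi; exact: psdmx_diag_ge0.
have M_adj i j k l : M j i l k = (M i j k l)^*%R.
  by have /hermP AE := proj1 choi_psd; rewrite -!M_choi [in LHS]AE !mxE.
have M_minor : `|M 0 1 0 1| ^+ 2 <= M 0 0 0 0 * M 1 1 1 1.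
  by rewrite -!M_choi; exact: psdmx_minor.
have M_tr i j : M i j 0 0 + M i j 1 1 = (i == j)%:R.
  have := S_tp (ketbra (g i) (g j)).
  rewrite -[in LHS](mxcoord_tr g g_basis) -[in RHS](mxcoord_tr g g_basis).
  rewrite mxcoord_ketbra // -/(M i j) /mxtrace !sum_ord2.
  by move=> ->; move: i j; elim/ord2P; elim/ord2P; rewrite !mxE /= ?addr0 ?add0r.
have M_ad i j k l :
    (energies 0 i - energies 0 j - (energies 0 k - energies 0 l)) * M i j k l = 0.
  have := S_ad (ketbra (g i) (g j)).
  rewrite (ad_diag_ketbra _ _ _ _ mxcoord_hamiltonian) linearZ.
  move=> /(congr1 (fun A => mxcoord g A k l)).
  rewrite linearZ mxcoord_ad mxcoord_hamiltonian ad_diag mxE -/(M i j) => E.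
  by rewrite mulrBl E subrr.
have ME i j : mxcoord g (S (ketbra (g i) (g j))) = M i j by [].
clearbody M.
have M_eq0 i j k l :
    ~~ ((i == j) && (k == l) || (i == k) && (j == l)) -> M i j k l = 0.
  move=> /negP ne; have /eqP := M_ad i j k l.
  rewrite mulf_eq0 !mxE -!rmorphB (inj_eq (@complexI R) _ 0) subr_eq0.
  by move=> /orP[/eqP/(level_gap _ _ _ _ _ _ ltE)|/eqP].
(* The population moved from the second level to the first; it is real as a diagonal entry of the
   positive Choi matrix. *)
pose lam := complex.Re (M 1 1 0 0).
have M1100 : M 1 1 0 0 = lam%:C by rewrite RRe_real // ger0_real.
have M1111 : M 1 1 1 1 = (1 - lam)%:C.
  by rewrite rmorphB rmorph1 /= -M1100 -(M_tr 1 1 : _ = 1) addrC addKr.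
have M0011 : M 0 0 1 1 = (lam * q)%:C.
  (* The (1, 1) coordinate of [S G = G] reads [w 0 0 * M 0 0 1 1 + q * w 0 0 * (1 - lam) = q * w 0
     0], and [w 0 0] cancels. *)
  have [G [w [w0 wE GE SG]]] := gibbs_state.
  have {}GE : G = w 0 0 *: ketbra (g 0) (g 0) + w 0 1 *: ketbra (g 1) (g 1).
    by apply: (mxcoord_inj g g_basis); rewrite GE mxcoord_diag.
  have /SG := S_gibbs; rewrite GE linearD !linearZ.
  move=> /(congr1 (fun A => mxcoord g A 1 1)).
  rewrite mxcoord_diag linearD !linearZ /= !ME !mxE eqxx mulr1n M1111 wE.
  move=> E; apply: (mulfI w0).
  apply: (addIr (q%:C * w 0 0 * (1 - lam)%:C)); rewrite E rmorphM rmorphB /=.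
  by ring.
have M0000 : M 0 0 0 0 = (1 - lam * q)%:C.
  by rewrite rmorphB rmorph1 /= -M0011 -(M_tr 0 0 : _ = 1) addrK.
exists lam, (M 0 1 0 1); split.
- have := M_ge0 1 0; have := M_ge0 1 1.
  by rewrite M1100 M1111 !ler0c subr_ge0 => -> ->.
- by rewrite mulrC rmorphM /= -M0000 -M1111.
- apply: qubit_mapP => i j; rewrite ME; apply/matrixP => k l.
  move: i j k l; elim/ord2P; elim/ord2P; elim/ord2P; elim/ord2P; rewrite !mxE /=;
  rewrite ?M1100 ?M1111 ?M0011 ?M0000 ?mulr0 ?mulr1 ?addr0 ?add0r //;
  (* Hermiticity of the Choi matrix makes the two coherence factors conjugate; all other remaining
     coefficients vanish by the gap condition. *)
  by rewrite -?M_adj // M_eq0.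
Qed.
End Thermal.
End Qubit.

(** * The parametrisation of (a) and the semigroup representation of (b) *)

Theorem mainTheorem4 (R : realType) (HS : 'M[R[i]]_2)
    (g : 'I_2 -> 'cV[R[i]]_2) (E1 E2 : R) (T : \bar R)
    (HS_herm : HS \is hermsymmx)
    (g_basis : orthonormal_basis g)
    (HS_spec : HS = E1%:C *: ketbra (g 0) (g 0) + E2%:C *: ketbra (g 1) (g 1))
    (ltE : E1 < E2)
    (T_gt0 : (0 < T)%E) :
  let q := boltzmann (E2 - E1) T in
  (forall S : 'End('M[R[i]]_2),
     EnTO HS T S <->
     exists lam r phi : R,
       [/\ 0 <= lam <= 1,
           0 <= r <= Num.sqrt ((1 - lam) * (1 - lam * q)),
           - pi <= phi < pi
         & choi_mx g S = qubit_choi q lam r phi])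
  /\
  [/\ (forall S, dom_Psi q g S -> Psi_fst g S = (Psi g S).1%:C),
      (forall S1 S2, dom_Psi q g S1 -> dom_Psi q g S2 ->
         Psi g S1 = Psi g S2 -> S1 = S2),
      (forall S1 S2, dom_Psi q g S1 -> dom_Psi q g S2 ->
         dom_Psi q g (S1 \o S2)%VF
         /\ Psi g (S1 \o S2)%VF = opT q (Psi g S1) (Psi g S2)),
      associative (opT q)
    & left_id (0, 1) (opT q) /\ right_id (0, 1) (opT q)].
Proof.
move=> q.
have q0 : 0 <= q by apply/ltW/boltzmann_gt0.
have q1 : q <= 1 by exact: boltzmann_le1.
(* The radicand is nonnegative for these [lam], so the bound on [r] can be squared into the minor
   inequality. *)
have sqr_le lam r : 0 <= lam <= 1 -> 0 <= r ->
    (r <= Num.sqrt ((1 - lam) * (1 - lam * q))) =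
    (r ^+ 2 <= (1 - lam) * (1 - lam * q)).
  move=> /andP[lam0 lam1] r0.
  rewrite -[in LHS](ger0_norm r0) -sqrtr_sqr ler_sqrt //.
  by rewrite mulr_ge0 ?subr_ge0 // mulr_ile1.
split.
  move=> S; split.
    move=> /(EnTO_qubit _ _ _ _ _ _ HS_spec ltE T_gt0)[//|lam [c [lam01]]].
    have [r [phi [r0 phi_b ->]]] := polar_decomposition c.
    rewrite normc_polar lecR -sqr_le // => r_le /choi_qubitP SE.
    by exists lam, r, phi; split; rewrite ?r0 //; exact: SE.
  move=> [lam [r [phi [lam01 /andP[r0 r_le] _ /choi_qubitP SE]]]].
  apply: (qubit_EnTO _ g_basis _ _ _ _ HS_spec ltE T_gt0 lam _ _ lam01 _ (SE _)) => //.
  by rewrite normc_polar lecR -sqr_le.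
split.
- move=> S /dom_PsiP[//|lam [c /Psi_qubit[]//]].
  by move=> -> ->.
- move=> S1 S2 /dom_PsiP[//|lam1 [c1 SE1]] /dom_PsiP[//|lam2 [c2 SE2]].
  have [_ ->] := Psi_qubit _ g_basis _ _ _ _ SE1.
  have [_ ->] := Psi_qubit _ g_basis _ _ _ _ SE2.
  move=> [lamE cE]; apply/lfunP => X; apply: (mxcoord_inj g g_basis).
  by rewrite SE1 SE2 lamE cE.
- move=> S1 S2 /dom_PsiP[//|lam1 [c1 SE1]] /dom_PsiP[//|lam2 [c2 SE2]].
  have SE X := etrans (congr1 (mxcoord g) (comp_lfunE S1 S2 X)) (SE1 (S2 X)).
  have {}SE X : mxcoord g ((S1 \o S2)%VF X) =
      qubit_map q (lam1 + lam2 - lam1 * lam2 * (1 + q)) (c1 * c2) (mxcoord g X).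
    by rewrite SE SE2 qubit_map_comp.
  split; first by apply/dom_PsiP => //; eexists; eexists; exact: SE.
  have [_ ->] := Psi_qubit _ g_basis _ _ _ _ SE.
  have [_ ->] := Psi_qubit _ g_basis _ _ _ _ SE1.
  by have [_ ->] := Psi_qubit _ g_basis _ _ _ _ SE2.
(* Behind the polynomial identity: the substitution sending [x] to [1 - (1 + q) * x] turns the first
   component of [opT] into a product. *)
- by move=> [x1 c1] [x2 c2] [x3 c3]; congr pair; rewrite /= ?mulrA //; ring.
- by split=> -[x c]; congr pair; rewrite /= ?mul1r ?mulr1 //; ring.
Qed.
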